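(* Let $H, W$ be positive integers, let $\bm{M} \in \mathbb{R}^{HW \times HW}$ and let $\bm{\mathcal{M}} = \mathrm{fold}(\bm{M}) \in \mathbb{R}^{H \times W \times H \times W}$. Suppose there exist matrices $\bm{A}^1, \dots, \bm{A}^H \in \mathbb{R}^{W \times W}$ and $\bm{B}^1, \dots, \bm{B}^W \in \mathbb{R}^{H \times H}$ such that for all $i,k \in \{1,\dots,H\}$ and $j,l \in \{1,\dots,W\}$, $$\bm{\mathcal{M}}_{i,j,k,l} = [\bm{A}^i]_{j,l} \cdot [\bm{B}^l]_{i,k}.$$ Then $$\bm{M} = \bm{M}^A \times \bm{M}^B = \hat{\bm{M}}^A \odot \hat{\bm{M}}^B,$$ where $\bm{M}^A, \bm{M}^B, \hat{\bm{M}}^A, \hat{\bm{M}}^B \in \mathbb{R}^{HW \times HW}$ are $\bm{M}^A = \mathrm{unfold}(\bm{\mathcal{M}}^A)$, $\bm{M}^B = \mathrm{unfold}(\bm{\mathcal{M}}^B)$, $\hat{\bm{M}}^A = \mathrm{unfold}(\hat{\bm{\mathcal{M}}}^A)$, $\hat{\bm{M}}^B = \mathrm{unfold}(\hat{\bm{\mathcal{M}}}^B)$, and the 4D tensors in $\mathbb{R}^{H \times W \times H \times W}$ are given, for all $i,k \in \{1,\dots,H\}$ and $j,l \in \{1,\dots,W\}$, by $$\bm{\mathcal{M}}^A_{i,j,k,l} = \begin{cases} [\bm{A}^i]_{j,l} & k = i \\ 0 & k \ne i \end{cases}, \qquad \bm{\mathcal{M}}^B_{i,j,k,l} = \begin{cases}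 [\bm{B}^l]_{i,k} & j = l \\ 0 & j \ne l \end{cases},$$ $$\hat{\bm{\mathcal{M}}}^A_{i,j,k,l} = [\bm{A}^i]_{j,l}, \qquad \hat{\bm{\mathcal{M}}}^B_{i,j,k,l} = [\bm{B}^l]_{i,k}.$$
   Context: For a 4D tensor $\bm{\mathcal{T}} \in \mathbb{R}^{H \times W \times H \times W}$, $\mathrm{unfold}(\bm{\mathcal{T}}) \in \mathbb{R}^{HW \times HW}$ is the matrix with entries $[\mathrm{unfold}(\bm{\mathcal{T}})]_{(i-1)W + j,\ (k-1)W + l} = \bm{\mathcal{T}}_{i,j,k,l}$ for $1 \le i,k \le H$, $1 \le j,l \le W$; $\mathrm{fold}$ is the inverse operation. The symbol $\times$ between matrices denotes matrix multiplication, and $\odot$ denotes the Hadamard (entrywise) product. *)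

(* Defs.v *)
From HB Require Import structures.
From mathcomp Require Import all_boot all_order all_algebra.
From mathcomp Require Import reals.

Set Implicit Arguments.
Unset Strict Implicit.
Unset Printing Implicit Defensive.

Import GRing.Theory.
Local Open Scope ring_scope.

(* All indices are 0-based: the 1-based position (i - 1) W + j of the pair    *)
(* (i, j) in {1..H} x {1..W} becomes i * W + j.                               *)
Section FlatIndex.
Variables H W : nat.

Fact flat_subproof (i : 'I_H) (j : 'I_W) : (i * W + j < H * W)%N.
Proof.
apply: (@leq_trans (i.+1 * W)); first by rewrite mulSn addnC ltn_add2r.
by rewrite leq_mul2r ltn_ord orbT.
Qed.

Definition flat (i : 'I_H) (j : 'I_W) : 'I_(H * W) :=
  Ordinal (flat_subproof i j).

Fact flat_width_gt0 (r : 'I_(H * W)) : (0 < W)%N.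
Proof. by case: W r => [|//]; rewrite muln0 => -[]. Qed.

Fact flat_fst_subproof (r : 'I_(H * W)) : (r %/ W < H)%N.
Proof. by rewrite ltn_divLR ?ltn_ord // (flat_width_gt0 r). Qed.

Fact flat_snd_subproof (r : 'I_(H * W)) : (r %% W < W)%N.
Proof. by rewrite ltn_mod (flat_width_gt0 r). Qed.

Definition flat_fst (r : 'I_(H * W)) : 'I_H := Ordinal (flat_fst_subproof r).
Definition flat_snd (r : 'I_(H * W)) : 'I_W := Ordinal (flat_snd_subproof r).

Lemma flatK1 i j : flat_fst (flat i j) = i.
Proof.
apply: val_inj => /=.
by rewrite divnMDl ?(flat_width_gt0 (flat i j)) // divn_small ?addn0.
Qed.

Lemma flatK2 i j : flat_snd (flat i j) = j.
Proof. by apply: val_inj; rewrite /= modnMDl modn_small. Qed.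

Lemma flat_fst_snd r : flat (flat_fst r) (flat_snd r) = r.
Proof. by apply: val_inj; rewrite /= -divn_eq. Qed.

End FlatIndex.

Definition tensor4 (R : Type) (H W : nat) : Type :=
  'I_H -> 'I_W -> 'I_H -> 'I_W -> R.

Definition unfold (R : Type) (H W : nat) (T : tensor4 R H W) :
    'M[R]_(H * W) :=
  \matrix_(r, c) T (flat_fst r) (flat_snd r) (flat_fst c) (flat_snd c).

Definition fold (R : Type) (H W : nat) (M : 'M[R]_(H * W)) : tensor4 R H W :=
  fun i j k l => M (flat i j) (flat k l).

Lemma unfoldE (R : Type) (H W : nat) (T : tensor4 R H W) i j k l :
  unfold T (flat i j) (flat k l) = T i j k l.
Proof. by rewrite mxE !flatK1 !flatK2. Qed.

Lemma foldK (R : Type) (H W : nat) (M : 'M[R]_(H * W)) : unfold (fold M) = M.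
Proof. by apply/matrixP => r c; rewrite mxE /fold !flat_fst_snd. Qed.

Lemma unfoldK (R : Type) (H W : nat) (T : tensor4 R H W) i j k l :
  fold (unfold T) i j k l = T i j k l.
Proof. exact: unfoldE. Qed.

Definition hadamard (R : pzRingType) (m n : nat) (X Y : 'M[R]_(m, n)) :
    'M[R]_(m, n) :=
  map2_mx *%R X Y.

Section Factors.
Variables (R : pzRingType) (H W : nat).
Variables (A : 'I_H -> 'M[R]_W) (B : 'I_W -> 'M[R]_H).

Definition tensorA : tensor4 R H W :=
  fun i j k l => if k == i then A i j l else 0.

Definition tensorB : tensor4 R H W :=
  fun i j k l => if j == l then B l i k else 0.

Definition hat_tensorA : tensor4 R H W := fun i j k l => A i j l.

Definition hat_tensorB : tensor4 R H W := fun i j k l => B l i k.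

End Factors.

(* Main.v *)
Require Import Defs.
From mathcomp Require Import all_boot all_order all_algebra.
From mathcomp Require Import reals.
Import GRing.Theory.
Local Open Scope ring_scope.

(** The hypothesis is the Hadamard factorization of [M], read entry by entry. The matrix product
    collapses to the same entries, [A i j l * B l i k], by [mul_unfold_tensorAB]; both equalities
    follow. *)

(* In the sum for entry ((i, j), (k, l)) of the product, the left factor      *)
(* forces the summation index to have first coordinate i and the right factor *)
(* forces its second coordinate to be l, so one term survives.                *)
Lemma mul_unfold_tensorAB (R : pzRingType) (H W : nat)
    (A : 'I_H -> 'M[R]_W) (B : 'I_W -> 'M[R]_H) :
  unfold (tensorA A) *m unfold (tensorB B)
  = hadamard (unfold (hat_tensorA A)) (unfold (hat_tensorB B)).
Proof.
apply/matrixP => r c; rewrite [LHS]mxE.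
rewrite (bigD1 (flat (flat_fst r) (flat_snd c))) //= big1 => [|q qNrc].
  by rewrite addr0 !mxE flatK1 flatK2 /tensorA /tensorB !eqxx.
rewrite !mxE /tensorA /tensorB.
case: eqP => [q1|_]; last by rewrite mul0r.
case: eqP => [q2|_]; last by rewrite mulr0.
(* If both factors survive, [q] has the coordinates of the index already split off. *)
by rewrite -q1 -q2 flat_fst_snd eqxx in qNrc.
Qed.

Theorem theorem1 (R : realType) (H W : nat) (H_gt0 : (0 < H)%N)
    (W_gt0 : (0 < W)%N) (M : 'M[R]_(H * W))
    (A : 'I_H -> 'M[R]_W) (B : 'I_W -> 'M[R]_H)
    (hM : forall (i : 'I_H) (j : 'I_W) (k : 'I_H) (l : 'I_W),
       fold M i j k l = A i j l * B l i k) :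
  M = unfold (tensorA A) *m unfold (tensorB B)
  /\ unfold (tensorA A) *m unfold (tensorB B)
     = hadamard (unfold (hat_tensorA A)) (unfold (hat_tensorB B)).
Proof.
split; last exact: mul_unfold_tensorAB.
(* Writing [M] as [unfold (fold M)] exposes the entries that [hM] describes. *)
rewrite mul_unfold_tensorAB -[LHS]foldK.
by apply/matrixP => r c; rewrite !mxE hM.
Qed.
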